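(* (1) If $a < b$ are positive integers, then the $a$-floor quotient partial order strictly refines the $b$-floor quotient partial order; that is, $$\{(d,n) \in \mathbb{N}^+\times\mathbb{N}^+ : d \preccurlyeq_b n\} \subsetneq \{(d,n) \in \mathbb{N}^+\times\mathbb{N}^+ : d \preccurlyeq_a n\}.$$ (Thus the $a$-floor quotient orders form a nested decreasing sequence of order relations on $\mathbb{N}^+$ as $a$ increases.) (2) The intersection of all the $a$-floor quotient partial order relations is the divisor relation: $$\bigcap_{a \ge 1} \{(d,n) \in \mathbb{N}^+\times\mathbb{N}^+ : d \preccurlyeq_a n\} = \{(d,n) \in \mathbb{N}^+\times\mathbb{N}^+ : d \mid n\}.$$
   Context: $\mathbb{N}^+ = \{1,2,3,\ldots\}$. For positive integers $d, n$, one writes $d \preccurlyeq_1 n$ if $d = \lfloor n/k \rfloor$ for some positive integer $k$. For an integer $a \ge 1$, one writes $d \preccurlyeq_a n$ (''$d$ is an $a$-floor quotient of $n$'') if and only if $ad \preccurlyeq_1 an$, i.e. there is a positive integer $k$ with $ad = \lfloor an/k \rfloor$. One order relation refines another if every relation holding in the second also holds in the first; the refinement is strict if the two relations are different. *)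

(* Defs.v *)
From mathcomp Require Import all_boot.
From mathcomp Require Import classical_sets.

Set Implicit Arguments.
Unset Strict Implicit.
Unset Printing Implicit Defensive.

Local Open Scope classical_set_scope.

Definition pos_nat : set nat := [set n | 0 < n].

(* For k > 0, [n %/ k] is the floor of the rational number n / k. *)
Definition floor_quotient1 (d n : nat) : Prop :=
  exists2 k : nat, 0 < k & d = n %/ k.

Definition floor_quotient (a d n : nat) : Prop :=
  floor_quotient1 (a * d) (a * n).

(* Relations on the positive integers are sets of pairs of naturals whose
   two components are positive. *)
Definition floor_quotient_rel (a : nat) : set (nat * nat) :=
  [set dn | (pos_nat `*` pos_nat) dn /\ floor_quotient a dn.1 dn.2].

Definition divisor_rel : set (nat * nat) :=
  [set dn | (pos_nat `*` pos_nat) dn /\ dn.1 %| dn.2].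

(* Main.v *)
Require Import Defs.
From mathcomp Require Import all_boot.
From mathcomp Require Import classical_sets.
From mathcomp Require Import zify.
Local Open Scope classical_set_scope.

(** Clearing the floor in [a * d = (a * n) %/ k] gives
    [a * d * k <= a * n < (a * d + 1) * k]; writing [r = n - d * k] for the
    defect of divisibility, this says exactly [0 <= r] and [a * r < k]
    ([floor_quotientP]).  Everything follows from this criterion.

    A larger [a] makes the condition [a * r < k] more demanding, with the same
    witness [k], so the relations decrease with [a].  They decrease strictly
    from [a] to [b > a] because of the pair [(2, 2 * b + 1)]:
    the largest [k] with [2 * k <= 2 * b + 1] is [k = b], where [r = 1], and
    [a * 1 < b] holds while [b * 1 < b] fails; a smaller [k] only increases [r].
    Finally, [d * k <= n] bounds [k] by [n], so at [a = n] the condition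
    [n * r < k <= n] forces [r = 0], which is divisibility; conversely, if [d]
    divides [n], then [k = n %/ d] has [r = 0] and serves every [a]. *)

(** A statement free of [%/] in which the dependence on [a] is visibly
    monotone.  The positivity of [k] is absorbed by the strict inequality. *)
Lemma floor_quotientP (a d n : nat) : 0 < a ->
  floor_quotient a d n <->
  exists2 k, d * k <= n & a * (n - d * k) < k.
Proof.
move=> a_gt0; split=> -[k].
  move=> k_gt0 def_ad; exists k.
    by rewrite -(leq_pmul2l a_gt0) mulnA def_ad leq_divM.
  by rewrite mulnBr mulnA def_ad {1}(divn_eq (a * n) k) addKn ltn_mod.
move=> le_dk_n lt_ar_k; have k_gt0 : 0 < k by apply: leq_ltn_trans lt_ar_k.
exists k => //; rewrite -(subnKC le_dk_n) mulnDr mulnA divnMDl //.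
by rewrite divn_small ?addn0.
Qed.

Lemma floor_quotient_antimono (a b d n : nat) : 0 < a -> a <= b ->
  floor_quotient b d n -> floor_quotient a d n.
Proof.
move=> a_gt0 le_ab /floor_quotientP-/(_ (leq_trans a_gt0 le_ab))[k le_dk_n lt_k].
apply/floor_quotientP => //; exists k => //.
by apply: leq_ltn_trans lt_k; rewrite leq_mul2r le_ab orbT.
Qed.

Lemma floor_quotient_2_double_succ (a b : nat) : 0 < a -> a < b ->
  floor_quotient a 2 (2 * b + 1).
Proof.
move=> a_gt0 lt_ab; apply/floor_quotientP => //.
by exists b; rewrite ?leq_addr // addKn muln1.
Qed.

(** Parity keeps the defect [r] of an odd number at least [1], so [k] would
    have to exceed [b], while [2 * k <= 2 * b + 1] gives [k <= b]. *)
Lemma not_floor_quotient_2_double_succ (b : nat) : 0 < b ->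
  ~ floor_quotient b 2 (2 * b + 1).
Proof.
move=> b_gt0 /floor_quotientP-/(_ b_gt0)[k le_2k lt_k].
have le_b : b <= b * (2 * b + 1 - 2 * k) by rewrite leq_pmulr //; lia.
lia.
Qed.

Lemma dvdn_floor_quotient (a d n : nat) : 0 < a -> 0 < n ->
  d %| n -> floor_quotient a d n.
Proof.
move=> a_gt0 n_gt0 dvd_dn; apply/floor_quotientP => //.
have def_n : d * (n %/ d) = n by rewrite mulnC divnK.
exists (n %/ d); rewrite def_n // subnn muln0 divn_gt0.
  exact: dvdn_leq.
exact: dvdn_gt0 n_gt0 dvd_dn.
Qed.

(** A single order already detects divisibility at a given [n]: the one of
    parameter [n]. *)
Lemma floor_quotient_self_dvdn (d n : nat) : 0 < d -> 0 < n ->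
  floor_quotient n d n -> d %| n.
Proof.
move=> d_gt0 n_gt0 /floor_quotientP-/(_ n_gt0)[k le_dk_n lt_k].
have le_kn : k <= n by apply: leq_trans le_dk_n; rewrite leq_pmull.
have : n * (n - d * k) < n * 1 by rewrite muln1 (leq_trans lt_k).
rewrite ltn_pmul2l // ltnS leqn0 subn_eq0 => le_n_dk.
by rewrite (_ : n = d * k) ?dvdn_mulr //; apply/eqP; rewrite eqn_leq le_n_dk.
Qed.

Theorem theorem1p4 :
  (forall a b : nat, 0 < a -> a < b ->
     floor_quotient_rel b `<` floor_quotient_rel a) /\
  \bigcap_(a in pos_nat) floor_quotient_rel a = divisor_rel.
Proof.
split=> [a b a_gt0 lt_ab|].
  split=> [[d n] [pos_dn b_dn]|sub_ab].
    split=> //; exact: floor_quotient_antimono a_gt0 (ltnW lt_ab) b_dn.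
  have [|_] := sub_ab (2, 2 * b + 1).
    split; last exact: floor_quotient_2_double_succ.
    by split=> //=; rewrite /pos_nat /= addn1.
  by apply: not_floor_quotient_2_double_succ; apply: leq_trans lt_ab.
apply/seteqP; split=> [[d n] all_dn|[d n] [pos_dn dvd_dn] a a_gt0].
  have [[d_gt0 n_gt0] _] := all_dn 1 isT.
  have [pos_dn n_dn] := all_dn n n_gt0.
  by split=> //; apply: floor_quotient_self_dvdn n_dn.
split=> //; apply: dvdn_floor_quotient => //; exact: pos_dn.2.
Qed.
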